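(* Let $(G,s,t)$ be a minimal weak link of weight $w$, with terminal degrees $d_s,d_t$, and let $p$ be the number of centre vertices. Then: if $w>3$ then $p\ge 1$; if $w>5$ then $p\ge 2$; and if $w\le 7$ then $d_s+d_t\le \frac{w+3}{2}$.
   Context: A Shannon game (link) $(G,s,t)$ consists of a finite simple graph $G$ and two distinct designated vertices $s,t$, the terminals. Two players, Short and Cut, alternately select a not-yet-selected non-terminal vertex; Short claims his vertices, Cut deletes his. Short wins if at the end there is an $s$–$t$ path all of whose internal vertices are claimed by Short; otherwise Cut wins. The link is strong if Short has a winning strategy when moving second, and weak if Short has a winning strategy when moving first but not when moving second. A weak link is minimal if deleting any single edge of $G$ produces a game in which Short has no winning strategy as first player. The weight $w$ is the number of non-terminal vertices. The borders are $B_s=\Gamma(s)$ and $B_t=\Gamma(t)$ (neighbourhoods of the terminals); the centre is the set of vertices that are neither terminals nor in $B_s\cup B_t$, and $p$ denotes its size. *)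

(* Defs.v *)
From mathcomp Require Import all_boot all_order all_algebra.

Set Implicit Arguments.
Unset Strict Implicit.
Unset Printing Implicit Defensive.

(* A link (G, s, t) is given by a vertex type T, an adjacency relation e on T  *)
(* and the terminals s and t.  That e is symmetric and irreflexive and s != t  *)
(* is assumed where the definitions are used.                                  *)
Section ShannonGame.

Variables (T : finType) (e : rel T) (s t : T).

Definition nbhd (x : T) : {set T} := [set y | e x y].

Definition degree (x : T) : nat := #|nbhd x|.

Definition nonterminals : {set T} := ~: [set s; t].

Definition weight : nat := #|nonterminals|.

Definition centre : {set T} := nonterminals :\: (nbhd s :|: nbhd t).

(* A play is recorded as the sequence of selected vertices, whichever player   *)
(* selected them; [first] says whether Short makes the move of index 0.        *)
Definition legal_history (h : seq T) : Prop :=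
  uniq h /\ {subset h <= nonterminals}.

Definition complete_play (h : seq T) : Prop :=
  legal_history h /\ size h = weight.

Definition short_turn (first : bool) (i : nat) : bool := first (+) odd i.

Definition claimed (first : bool) (h : seq T) : {set T} :=
  [set x in h | short_turn first (index x h)].

Definition short_connects (S : {set T}) : Prop :=
  exists q : seq T,
    [/\ path e s (rcons q t), uniq (s :: rcons q t) & {subset q <= S}].

(* A strategy maps the history so far to Short's next selection.               *)
Definition legal_strategy (first : bool) (sigma : seq T -> T) : Prop :=
  forall h : seq T, legal_history h -> size h < weight ->
    short_turn first (size h) ->
    sigma h \in nonterminals /\ sigma h \notin h.

Definition follows (first : bool) (sigma : seq T -> T) (h : seq T) : Prop :=
  forall i : nat, i < size h -> short_turn first i ->
    nth s h i = sigma (take i h).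

Definition short_wins (first : bool) : Prop :=
  exists2 sigma : seq T -> T, legal_strategy first sigma &
    forall h : seq T, complete_play h -> follows first sigma h ->
      short_connects (claimed first h).

Definition strong_link : Prop := short_wins false.

Definition weak_link : Prop := short_wins true /\ ~ strong_link.

End ShannonGame.

Definition del_edge (T : finType) (e : rel T) (x y : T) : rel T :=
  fun u v => e u v && ([set u; v] != [set x; y]).

Definition minimal_weak_link (T : finType) (e : rel T) (s t : T) : Prop :=
  weak_link e s t /\
  forall x y : T, e x y -> ~ short_wins (del_edge e x y) s t true.

(* Main.v *)
(* If some vertex is adjacent to both terminals, the link is a path of length  *)
(* two plus isolated vertices.  Otherwise the borders are disjoint, so that    *)
(* w = d_s + d_t + p and the degree bound follows from the bounds on p.        *)
(* For these, let p <= 1, with v the only possible centre vertex.  Every       *)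
(* winning set contains an edge ac between B_s and B_t, or a triple a v c with *)
(* a in B_s and c in B_t.  Either G contains one of a few explicit first-mover *)
(* wins (two edges sharing a vertex, or a configuration of v and four border   *)
(* vertices), and then minimality makes all other vertices isolated, hence     *)
(* central, which bounds w; or the border edges form a matching that, with at  *)
(* most one extra pair {k, v}, meets every winning set in a full pair, and Cut *)
(* wins by pairing.                                                            *)

Require Import Defs.
From mathcomp Require Import all_boot all_order all_algebra.
From mathcomp Require Import zify.

Set Implicit Arguments.
Unset Strict Implicit.
Unset Printing Implicit Defensive.

(** Both players' sides reduce to finite certificates. A forced sequence of at most three Short
    moves, checked by [attack], becomes a strategy through [attack_short_wins]; a partial matching
    that contributes a full pair to every winning set refutes Short through [pairing_cut_wins].
    Minimality enters through [minimal_support]: a forced win along a few routes leaves no edge at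
    any vertex off them, and isolated vertices are central, whence [weight_le_centre].

    The two sides meet in [weight_bound], which gives w <= 3 + 2p when p <= 1. With disjoint borders
    d_s + d_t = w - p, so the degree bound amounts to w <= 2p + 3; for p >= 2 this is automatic from
    w <= 7. *)

Section Plays.

Variables (T : finType) (s t : T).

Notation NT := (nonterminals s t).

(** * Histories of play *)

Lemma short_turnS first n : short_turn first n.+1 = ~~ short_turn first n.
Proof. by rewrite /short_turn /= addbN. Qed.

Lemma claimed_sub first (h : seq T) : {subset claimed first h <= h}.
Proof. by move=> x; rewrite inE => /andP[]. Qed.

Lemma claimed_rcons first (h : seq T) x : x \notin h ->
  claimed first (rcons h x) =
    if short_turn first (size h) then x |: claimed first h else claimed first h.
Proof.
move=> xh; apply/setP => z.
rewrite inE mem_rcons in_cons -cats1 index_cat.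
have [->|zx] := eqVneq z x.
  rewrite (negbTE xh) /= eqxx addn0.
  case: ifP => _; rewrite ?setU11 //.
  by apply/esym/negbTE; apply: contra xh => /claimed_sub.
rewrite (fun_if (fun A : {set T} => z \in A)) in_setU1 (negbTE zx) /= if_same.
by rewrite inE; case: (z \in h).
Qed.

Lemma legal_history_rcons (h : seq T) x :
  legal_history s t (rcons h x) <->
  [/\ legal_history s t h, x \in NT & x \notin h].
Proof.
rewrite /legal_history rcons_uniq; split.
  case=> /andP[xh uh] sub; split=> //; last first.
  - by apply: sub; rewrite mem_rcons mem_head.
  - by split=> // z zh; apply: sub; rewrite mem_rcons in_cons zh orbT.
case=> -[uh sub] xN xh; split; first by rewrite xh.
by move=> z; rewrite mem_rcons in_cons => /predU1P[->|/sub].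
Qed.

Lemma follows_rcons first sigma (h : seq T) x :
  follows s first sigma (rcons h x) <->
  follows s first sigma h /\ (short_turn first (size h) -> x = sigma h).
Proof.
split=> [fol|[fol xE] i].
  split=> [i lti turn|turn].
    have := fol i; rewrite size_rcons ltnS ltnW // => /(_ isT turn).
    by rewrite nth_rcons lti -cats1 takel_cat // ltnW.
  have := fol (size h); rewrite size_rcons ltnSn => /(_ isT turn).
  by rewrite nth_rcons ltnn eqxx -cats1 take_size_cat.
rewrite size_rcons ltnS leq_eqVlt => /predU1P[-> turn|lti turn].
  by rewrite nth_rcons ltnn eqxx -cats1 take_size_cat // xE.
by rewrite nth_rcons lti -cats1 takel_cat ?(ltnW lti) // fol.
Qed.

Lemma exists_free (h : seq T) : size h < weight s t ->
  exists x, (x \in NT) && (x \notin h).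
Proof.
move=> lth; apply/existsP; apply: contraTT lth => /existsPn full.
rewrite -leqNgt /weight (leq_trans _ (card_size h)) //.
apply/subset_leq_card/subsetP => x xN.
by have := full x; rewrite xN negbK.
Qed.

Lemma complete_play_full (h : seq T) : complete_play s t h ->
  NT :\: [set x in h] = set0.
Proof.
case=> -[uh sub] szh; apply/eqP; rewrite setD_eq0.
suff /eqP <- : [set x in h] == NT by [].
have card_h : #|[set x in h]| = size h.
  by rewrite -(card_uniqP uh); apply: eq_card => x; rewrite inE.
rewrite eqEcard card_h szh leqnn andbT.
by apply/subsetP => x; rewrite inE => /sub.
Qed.

(** * Forced wins of Short *)

Section Attack.

Variable P : pred {set T}.

(* [attack n S U]: Short, to move, owning S and with U still unselected,      *)
(* reaches P within n of his moves.  Letting y range over the whole type      *)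
(* grants Cut the right to pass, so that no case of an exhausted U is needed. *)
Fixpoint attack (n : nat) (S U : {set T}) : bool :=
  P S || (if n is m.+1 then
    [exists x in U, [forall y, attack m (x |: S) (U :\ x :\ y)]] else false).

Lemma attack_goal n S U : P S -> attack n S U.
Proof. by case: n => [|n] /= ->. Qed.

Lemma attack_step n (S U : {set T}) x : x \in U ->
  (forall y, attack n (x |: S) (U :\ x :\ y)) -> attack n.+1 S U.
Proof.
move=> xU att /=; apply/orP; right.
by apply/existsP; exists x; rewrite xU; apply/forallP.
Qed.

Lemma attackS n S U : attack n S U -> attack n.+1 S U.
Proof.
elim: n S U => [|n IH] S U; first by case/orP=> // PS; apply: attack_goal.
case/orP=> [/attack_goal-> //|/existsP[x /andP[xU /forallP att]]].
by apply: (@attack_step _ _ _ x xU) => y; apply: IH.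
Qed.

(** The budget stays at [n] instead of dropping, by [attackS]. A strategy can therefore keep one
    fixed [n] throughout the play. *)
Lemma attack_next n (S U : {set T}) : ~~ P S -> attack n S U ->
  exists2 x, x \in U & forall y, attack n (x |: S) (U :\ x :\ y).
Proof.
case: n => [|n] /= /negbTE-> //= /existsP[x /andP[xU /forallP att]].
by exists x => // y; apply: attackS.
Qed.

Lemma attack_finish n (S U : {set T}) x : x \in U -> P (x |: S) -> attack n.+1 S U.
Proof. by move=> xU Px; apply: (attack_step xU) => y; apply: attack_goal. Qed.

Lemma attack_fork (S U : {set T}) x y z : x \in U -> y \in U -> z \in U ->
  x != y -> x != z -> y != z -> P (y |: (x |: S)) -> P (z |: (x |: S)) -> attack 2 S U.
Proof.
move=> xU yU zU xy xz yz Py Pz; apply: (attack_step xU) => u.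
have [->|yu] := eqVneq u y.
  by apply: attack_finish Pz; rewrite !inE zU eq_sym yz eq_sym xz.
by apply: attack_finish Py; rewrite !inE yU eq_sym yu eq_sym xy.
Qed.

(** Claiming [x] threatens to win at [y], so only the reply [y] has to be analysed further. *)
Lemma attack_threat n (S U : {set T}) x y : x \in U -> y \in U -> x != y ->
  P (y |: (x |: S)) -> attack n.+1 (x |: S) (U :\ x :\ y) -> attack n.+2 S U.
Proof.
move=> xU yU xy Py att; apply: (attack_step xU) => u.
have [->//|yu] := eqVneq u y.
by apply: attack_finish Py; rewrite !inE yU eq_sym yu eq_sym xy.
Qed.

Lemma attack_short_wins (e : rel T) first n :
  (forall S S' : {set T}, S \subset S' -> P S -> P S') ->
  (forall S, P S -> short_connects e s t S) ->
  (if first then (attack n set0 NT : Prop)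
   else forall y, attack n set0 (NT :\ y)) ->
  short_wins e s t first.
Proof.
move=> Pmono Pconn att0.
pose free (h : seq T) := NT :\: [set x in h].
pose good h x := [forall y, attack n (x |: claimed first h) (free h :\ x :\ y)].
(* Short makes a good move if there is one and otherwise takes any free vertex, which keeps the
   strategy legal on every history. *)
pose sigma h := if [pick x in free h | good h x] is Some x then x
                else odflt s [pick x in free h].
have free_rcons h x : free (rcons h x) = free h :\ x.
  by apply/setP => z; rewrite !inE mem_rcons in_cons negb_or andbA.
exists sigma => [h _ lth _|h hcomp hfol].
  rewrite /sigma; case: pickP => [x /andP[]|_].
    by rewrite !inE => /andP[xh xN]; rewrite xh xN.
  case: pickP => [x|none]; first by rewrite !inE => /andP[xh xN]; rewrite xh xN.
  have [x /andP[xN xh]] := exists_free lth.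
  by have := none x; rewrite !inE xh /=; move: xN; rewrite !inE => ->.
have inv : if short_turn first (size h) then (attack n (claimed first h) (free h) : Prop)
    else forall y, attack n (claimed first h) (free h :\ y).
  case: hcomp => hleg _; elim/last_ind: h hleg hfol => [_ _|h x IH].
    have -> : claimed first [::] = set0 :> {set T} by apply/setP => z; rewrite !inE.
    have -> : free [::] = NT by apply/setP => z; rewrite !inE.
    by rewrite /short_turn addbF.
  move=> /legal_history_rcons[hleg xN xh] /follows_rcons[hfol xE].
  rewrite size_rcons short_turnS claimed_rcons // free_rcons.
  move: (IH hleg hfol) xE; case: ifP => _ /=; last by move=> att _; apply: att.
  move=> att /(_ isT) xE y.
  have [PS|nPS] := boolP (P (claimed first h)).
    by apply/attack_goal/(Pmono _ _ _ PS)/subsetUr.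
  suff /forallP: good h x by [].
  rewrite xE /sigma; case: pickP => [z /andP[] //|none].
  have [z zU /forallP zgood] := attack_next nPS att.
  by have := none z; rewrite /= zU /good zgood.
(* At the end of the play nothing is free, and an attack without free vertices must already have
   reached its goal. *)
have attP m S : attack m S set0 -> P S.
  by case: m => [|m] /=; rewrite ?orbF // => /orP[//|/existsP[x]]; rewrite inE.
move: inv; rewrite [free h]complete_play_full //.
case: ifP => _ => [/attP /Pconn //|/(_ s)].
by rewrite set0D => /attP /Pconn.
Qed.

End Attack.

(** * Cut's pairing strategy *)

(** Against a given strategy of Short, one complete play is built in which Cut answers each vertex
    of Short with its partner. Short then never owns a full pair, hence no winning set. *)
Lemma pairing_cut_wins (e r : rel T) first :
  symmetric r -> (forall x y z, r x y -> r x z -> y = z) -> irreflexive r ->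
  (forall S : {set T}, S \subset NT -> short_connects e s t S ->
     exists x y, [/\ x \in S, y \in S & r x y]) ->
  ~ short_wins e s t first.
Proof.
move=> rsym rfun rirr hit [sigma sleg swin].
(* The partner of a vertex of Short is already with Cut, unless Short has only *)
(* just claimed that vertex and it is Cut's turn to answer.                    *)
pose inv h := forall x y, x \in claimed first h -> r x y ->
  y \notin claimed first h /\ (y \in NT -> y \notin h ->
    ~~ short_turn first (size h) /\ x = last s h).
have play n : n <= weight s t -> exists h,
    [/\ legal_history s t h, size h = n, follows s first sigma h & inv h].
  elim: n => [_|n IH ltn].
    by exists [::]; split=> // x y; rewrite inE.
  have [h [hleg szh hfol hinv]] := IH (ltnW ltn).
  have [turn|turn] := boolP (short_turn first (size h)).
    have [zN zh] := sleg h hleg (etrans (congr1 (fun k => k < _) szh) ltn) turn.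
    exists (rcons h (sigma h)); split; rewrite ?size_rcons ?szh //.
    - exact/legal_history_rcons.
    - exact/follows_rcons.
    have old x y : x \in claimed first h -> r x y -> y \in NT -> y \in h.
      move=> xc xy yN; apply: contraT => yh.
      by have [_ /(_ yN yh)[]] := hinv x y xc xy; rewrite turn.
    move=> x y; rewrite claimed_rcons // turn !in_setU1 size_rcons short_turnS.
    rewrite turn /= last_rcons mem_rcons in_cons negb_or.
    case/predU1P=> [-> zy|xc xy].
      split=> //; apply/andP; split.
        by apply: contraL zy => /eqP->; rewrite rirr.
      apply: contra zh => yc; apply: old yc _ zN; by rewrite rsym.
    split; last by move=> yN; rewrite (old _ _ xc xy yN) orbT.
    rewrite (hinv x y xc xy).1 andbT.
    by apply: contra zh => /eqP yz; rewrite -yz; apply: (old _ _ xc xy); rewrite yz.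
  (* When no partner is free, Cut takes any free vertex. If Cut opens, [last s h] is the default
     [s]; Short owns nothing yet, so every choice is safe. *)
  have [z [zN zh zr]] : exists z, [/\ z \in NT, z \notin h &
      forall y, y \in NT -> y \notin h -> r (last s h) y -> z = y].
    case: (pickP [pred y | [&& y \in NT, y \notin h & r (last s h) y]]).
      by move=> z /and3P[zN zh rz]; exists z; split=> // y _ _ /(rfun _ _ _ rz).
    move=> none; have [|z /andP[zN zh]] := @exists_free h; first by rewrite szh.
    exists z; split=> // y yN yh ry.
    by have := none y; rewrite /= yN yh ry.
  exists (rcons h z); split; rewrite ?size_rcons ?szh //.
  - exact/legal_history_rcons.
  - by apply/follows_rcons; split=> // /(negP turn).
  move=> x y; rewrite claimed_rcons // (negbTE turn) => xc xy.
  have [yc yh] := hinv x y xc xy; split=> // yN.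
  rewrite mem_rcons in_cons negb_or => /andP[yz yh'].
  have [_ xl] := yh yN yh'.
  by rewrite (zr y yN yh') ?eqxx // -xl in yz.
have [h [hleg szh hfol hinv]] := play _ (leqnn _).
have [] := hit (claimed first h) _ (swin h (conj hleg szh) hfol).
  by apply/subsetP => x /claimed_sub; case: hleg => _; apply.
move=> x [y [xc yc xy]].
by have [] := hinv x y xc xy; rewrite yc.
Qed.

End Plays.

(** * Routes and the effect of minimality *)

Section Routes.

Variables (T : finType) (s t : T).

Notation NT := (nonterminals s t).

(** Only internal vertices are listed, so [[::]] stands for a direct edge between the terminals. *)
Definition route (e : rel T) (q : seq T) : bool :=
  path e s (rcons q t) && uniq (s :: rcons q t).

Definition covers (F : seq (seq T)) (S : {set T}) : bool :=
  has (all (mem S)) F.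

Lemma covers_mono F (S S' : {set T}) : S \subset S' -> covers F S -> covers F S'.
Proof.
move=> /subsetP SS' /hasP[q qF /allP qS]; apply/hasP; exists q => //.
by apply/allP => x /qS /SS'.
Qed.

Lemma routes_short_wins (e : rel T) first n F : all (route e) F ->
  (if first then (attack (covers F) n set0 NT : Prop)
   else forall y, attack (covers F) n set0 (NT :\ y)) ->
  short_wins e s t first.
Proof.
move=> /allP rF; apply: attack_short_wins => [S S'|S]; first exact: covers_mono.
move=> /hasP[q qF /allP qS]; exists q.
by have /andP[pq uq] := rF q qF; split=> // x /qS.
Qed.

(** An edge at a vertex off all routes could be deleted without harming the routes, and Short would
    still win moving first. *)
Lemma minimal_support (e : rel T) n F x y : minimal_weak_link e s t ->
  all (route e) F -> attack (covers F) n set0 NT -> e x y ->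
  x \in s :: t :: flatten F.
Proof.
move=> [_ emin] rF att exy; apply: contraT => xF.
case: (emin x y exy); apply: (routes_short_wins (first := true)) att.
apply/allP => q qF; have /andP[pq uq] := allP rF q qF.
rewrite /route uq andbT.
have qx z : z \in s :: rcons q t -> z != x.
  rewrite in_cons mem_rcons in_cons => zq; apply: contraNneq xF => <-.
  rewrite !in_cons; case/or3P: zq => [->|->|zq]; rewrite ?orbT //.
  by apply/orP; right; apply/orP; right; apply/flattenP; exists q.
rewrite -(eq_in_path (P := predC1 x) (e := e)) // => [u v ux vx|].
  rewrite /del_edge; case: (e u v) => //=; apply/esym/eqP => /setP/(_ x).
  by rewrite !inE eqxx [x == u]eq_sym (negbTE ux) [x == v]eq_sym (negbTE vx).
by apply/allP => z /qx.
Qed.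

(** A nonterminal off all routes is isolated, hence in the centre; [l] collects the route vertices
    that may lie outside it. *)
Lemma weight_le_centre (e : rel T) n F (l : seq T) : symmetric e ->
  minimal_weak_link e s t -> all (route e) F ->
  attack (covers F) n set0 NT ->
  {in flatten F, forall x, (x \in l) || (x \in centre e s t)} ->
  weight s t <= #|centre e s t| + size l.
Proof.
move=> e_sym emin rF att Fl.
suff sub : NT \subset centre e s t :|: [set x in l].
  apply: leq_trans (subset_leq_card sub) (leq_trans (leq_card_setU _ _) _).
  by rewrite leq_add2l cardsE card_size.
apply/subsetP => x xN; rewrite !in_setU inE orbC.
case: (boolP (x \in flatten F)) => [/Fl //|xF].
have isol y : ~~ e x y.
  apply: contra xF => /(minimal_support emin rF att); move: xN.
  by rewrite !inE negb_or => /andP[/negbTE-> /negbTE->].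
apply/orP; right.
by rewrite inE xN andbT !inE negb_or e_sym isol e_sym isol.
Qed.

End Routes.

(** * Links with disjoint borders *)

Section Borders.

Variables (T : finType) (e : rel T) (s t : T).
Variables (e_sym : symmetric e) (e_irr : irreflexive e) (s_neq_t : s != t).
Variable st_free : e s t = false.
Variable disjoint_borders : forall x, e s x -> e x t -> False.

Notation NT := (nonterminals s t).

Lemma border_s_NT a : e s a -> a \in NT.
Proof.
move=> sa; rewrite !inE negb_or; apply/andP; split.
  by apply: contraTneq sa => ->; rewrite e_irr.
by apply: contraTneq sa => ->; rewrite st_free.
Qed.

Lemma border_t_NT c : e c t -> c \in NT.
Proof.
move=> ct; rewrite !inE negb_or; apply/andP; split.
  by apply: contraTneq ct => ->; rewrite st_free.
by apply: contraTneq ct => ->; rewrite e_irr.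
Qed.

Lemma borders_neq a c : e s a -> e c t -> a != c.
Proof. by move=> sa; apply: contraTneq => <-; apply/negP/disjoint_borders. Qed.

(** If [v] were [s] or [t], then [c] or [a] would be a common neighbour of the terminals. *)
Lemma middle_NT a v c : e s a -> e a v -> e v c -> e c t -> v \in NT.
Proof.
move=> sa av vc ct; rewrite !inE negb_or; apply/andP; split.
  by apply/eqP => vs; rewrite vs in vc; apply: disjoint_borders vc ct.
by apply/eqP => vt; rewrite vt in av; apply: disjoint_borders sa av.
Qed.

Lemma e_neq x y : e x y -> x != y.
Proof. by apply: contraTneq => ->; rewrite e_irr. Qed.

Lemma route2 a b : e s a -> e a b -> e b t -> route s t e [:: a; b].
Proof.
move=> sa ab bt; have := border_s_NT sa; have := border_t_NT bt.
rewrite /route /= sa ab bt !inE !negb_or => /andP[bs bt'] /andP[as_ at_].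
by rewrite eq_sym as_ eq_sym bs s_neq_t borders_neq // at_ bt'.
Qed.

Lemma route3 a v c : e s a -> e a v -> e v c -> e c t ->
  route s t e [:: a; v; c].
Proof.
move=> sa av vc ct; have := border_s_NT sa; have := border_t_NT ct.
have := middle_NT sa av vc ct.
rewrite /route /= sa av vc ct !inE !negb_or.
move=> /andP[vs vt] /andP[cs ct'] /andP[as_ at_].
rewrite eq_sym as_ eq_sym vs eq_sym cs s_neq_t (e_neq av) (e_neq vc).
by rewrite borders_neq // at_ ct' vt.
Qed.

Ltac distinct := solve [assumption | rewrite eq_sym; assumption
  | apply: borders_neq; assumption | rewrite eq_sym; apply: borders_neq; assumption
  | apply: e_neq; assumption | rewrite eq_sym; apply: e_neq; assumption].

Ltac available := solve [repeat (rewrite in_setD1; apply/andP; split);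
  first [assumption | apply: border_s_NT; assumption
  | apply: border_t_NT; assumption | distinct]].

Ltac covered := solve [rewrite /covers /= !inE !eqxx ?orbT //].

Ltac listed := let x := fresh "x" in let xF := fresh "xF" in
  move=> x; rewrite /= !inE => xF; repeat (case/orP: xF => xF);
  rewrite xF ?orbT //.

(** * Configurations that win for Short and bound the weight *)

Section Minimal.

Variable emin : minimal_weak_link e s t.

Lemma fork_s_weight a b c : e s a -> e a b -> e a c -> e b t -> e c t ->
  b != c -> weight s t <= #|centre e s t| + 3.
Proof.
move=> sa ab ac bt ct bc.
apply: (@weight_le_centre _ _ _ e 2 [:: [:: a; b]; [:: a; c]] [:: a; b; c]) => //.
- by rewrite /= !route2.
- apply: (@attack_fork _ _ _ _ a b c); first [available | distinct | covered].
- by move=> x; rewrite !inE => /or4P[] ->; rewrite ?orbT.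
Qed.

Lemma fork_t_weight a b c : e a t -> e b a -> e c a -> e s b -> e s c ->
  b != c -> weight s t <= #|centre e s t| + 3.
Proof.
move=> at_ ba ca sb sc bc.
apply: (@weight_le_centre _ _ _ e 2 [:: [:: b; a]; [:: c; a]] [:: a; b; c]) => //.
- by rewrite /= !route2.
- apply: (@attack_fork _ _ _ _ a b c); first [available | distinct | covered].
- by move=> x; rewrite !inE => /or4P[] ->; rewrite ?orbT.
Qed.

Variable v : T.
Variables (sv : e s v = false) (vt : e v t = false).

Lemma cross_centre a c : e s a -> e a v -> e v c -> e c t ->
  v \in centre e s t.
Proof.
move=> sa av vc ct.
have := middle_NT sa av vc ct.
by rewrite !inE sv [e t v]e_sym vt => ->.
Qed.

(** Here [v] is itself central, so only the at most four vertices of [l] add to the centre. *)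
Lemma cross_weight a c F l : e s a -> e a v -> e v c -> e c t ->
  all (route s t e) F -> attack (covers F) 3 set0 NT -> size l <= 4 ->
  {in flatten F, forall x, x \in v :: l} ->
  0 < #|centre e s t| /\ weight s t <= #|centre e s t| + 4.
Proof.
move=> sa av vc ct rF att szl Fl; have vC := cross_centre sa av vc ct.
split; first by apply/card_gt0P; exists v.
apply: leq_trans (weight_le_centre e_sym emin rF att (l := l) _) _.
  by move=> x /Fl; rewrite in_cons => /predU1P[->|->]; rewrite ?vC ?orbT.
by rewrite leq_add2l.
Qed.

(** Short takes [v]. Cut's reply spares both vertices on one side and at least one on the other;
    claiming that one forks the remaining two. *)
Lemma square_weight a1 a2 c1 c2 : e s a1 -> e s a2 -> e c1 t -> e c2 t ->
  e a1 v -> e a2 v -> e v c1 -> e v c2 -> a1 != a2 -> c1 != c2 ->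
  0 < #|centre e s t| /\ weight s t <= #|centre e s t| + 4.
Proof.
move=> sa1 sa2 c1t c2t a1v a2v vc1 vc2 a12 c12.
have vN := middle_NT sa1 a1v vc1 c1t.
pose F := [:: [:: a1; v; c1]; [:: a1; v; c2]; [:: a2; v; c1]; [:: a2; v; c2]].
apply: (@cross_weight a1 c1 F [:: a1; a2; c1; c2]) => //; last by rewrite /F; listed.
  by rewrite /= !route3.
apply: (attack_step vN) => u.
have [<-|ua1] := eqVneq a1 u.
  apply: (@attack_fork _ _ _ _ a2 c1 c2); first [available | distinct | covered].
have [<-|ua2] := eqVneq a2 u.
  apply: (@attack_fork _ _ _ _ a1 c1 c2); first [available | distinct | covered].
have [<-|uc1] := eqVneq c1 u.
  apply: (@attack_fork _ _ _ _ c2 a1 a2); first [available | distinct | covered].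
apply: (@attack_fork _ _ _ _ c1 a1 a2); first [available | distinct | covered].
Qed.

(** Claiming [a] forces Cut to [b]; then [v] forks [c] and [c']. *)
Lemma matched_s_weight a b c c' : e s a -> e a b -> e b t -> e a v ->
  e v c -> e v c' -> e c t -> e c' t -> c != c' -> c != b -> c' != b ->
  0 < #|centre e s t| /\ weight s t <= #|centre e s t| + 4.
Proof.
move=> sa ab bt av vc vc' ct c't cc' cb c'b.
have vN := middle_NT sa av vc ct.
have bv : b != v by apply: contraTneq bt => ->; rewrite vt.
pose F := [:: [:: a; b]; [:: a; v; c]; [:: a; v; c']].
apply: (@cross_weight a c F [:: a; b; c; c']) => //; last by rewrite /F; listed.
  by rewrite /= route2 ?route3.
apply: (@attack_threat _ _ _ _ _ a b); try first [available | distinct | covered].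
apply: (@attack_fork _ _ _ _ v c c'); first [available | distinct | covered].
Qed.

Lemma matched_t_weight c b a a' : e c t -> e b c -> e s b -> e v c ->
  e a v -> e a' v -> e s a -> e s a' -> a != a' -> a != b -> a' != b ->
  0 < #|centre e s t| /\ weight s t <= #|centre e s t| + 4.
Proof.
move=> ct bc sb vc av a'v sa sa' aa' ab a'b.
have vN := middle_NT sa av vc ct.
have bv : b != v by apply: contraTneq sb => ->; rewrite sv.
pose F := [:: [:: b; c]; [:: a; v; c]; [:: a'; v; c]].
apply: (@cross_weight a c F [:: c; b; a; a']) => //; last by rewrite /F; listed.
  by rewrite /= route2 ?route3.
apply: (@attack_threat _ _ _ _ _ c b); try first [available | distinct | covered].
apply: (@attack_fork _ _ _ _ v a a'); first [available | distinct | covered].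
Qed.

(** Claiming [a] forces Cut to [b]; then [c] forks [v] and [a']. *)
Lemma matched_both_weight a b c a' : e s a -> e a b -> e b t -> e a v ->
  e v c -> e c t -> e a' c -> e s a' -> b != c -> a' != a ->
  0 < #|centre e s t| /\ weight s t <= #|centre e s t| + 4.
Proof.
move=> sa ab bt av vc ct a'c sa' bc a'a.
have vN := middle_NT sa av vc ct.
have bv : b != v by apply: contraTneq bt => ->; rewrite vt.
have a'v : a' != v by apply: contraTneq sa' => ->; rewrite sv.
pose F := [:: [:: a; b]; [:: a; v; c]; [:: a'; c]].
apply: (@cross_weight a c F [:: a; b; c; a']) => //; last by rewrite /F; listed.
  by rewrite /= !route2 ?route3.
apply: (@attack_threat _ _ _ _ _ a b); try first [available | distinct | covered].
apply: (@attack_fork _ _ _ _ c v a'); first [available | distinct | covered].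
Qed.

End Minimal.

(** * Matchings that win for Cut *)

Section Cut.

Variable v : T.
Variables (sv : e s v = false) (vt : e v t = false).
Variable centre_v : {subset centre e s t <= [set v]}.

Lemma connects_cross (S : {set T}) : S \subset NT -> short_connects e s t S ->
  exists a c, [/\ a \in S, c \in S, e s a, e c t &
    e a c \/ [/\ v \in S, e a v & e v c]].
Proof.
move=> /subsetP SN [q [pq _ qS]].
pose cross := exists a c, [/\ a \in S, c \in S, e s a, e c t &
    e a c \/ [/\ v \in S, e a v & e v c]].
have kind y : y \in S -> [|| e s y, e y t | y == v].
  move=> /SN yN; apply: contraT; rewrite !negb_or => /and3P[sy yt yv].
  have /centre_v : y \in centre e s t.
    by move: yN; rewrite !inE [e t y]e_sym (negbTE sy) (negbTE yt) => ->.
  by rewrite inE (negbTE yv).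
(* The walk is in one of two states: at a neighbour of [s], or at [v] just after one. It has to
   enter the border of [t] eventually, and the step doing so yields the crossing. *)
have walk p : {subset p <= S} ->
    (forall a, a \in S -> e s a -> path e a (rcons p t) -> cross) /\
    (forall a, a \in S -> e s a -> e a v -> v \in S -> path e v (rcons p t) -> cross).
  elim: p => [|y p IH] pS.
    split=> [a aS sa|a aS sa av vS] /=; last by rewrite vt.
    by rewrite andbT => /(disjoint_borders sa).
  have yS : y \in S by apply: pS; rewrite mem_head.
  have [walk_s walk_v] : _ /\ _ := IH (fun z zp => pS z (mem_behead (s := y :: p) zp)).
  split=> [a aS sa|a aS sa av vS] /= /andP[].
    move=> ay py; case/or3P: (kind y yS) => [sy|yt|/eqP yv].
    - exact: walk_s py.
    - by exists a, y; split=> //; left.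
    - by rewrite yv in ay yS py; apply: (walk_v a).
  move=> vy py; case/or3P: (kind y yS) => [sy|yt|/eqP yv].
  - exact: walk_s py.
  - by exists a, y; split=> //; right.
  - by rewrite yv e_irr in vy.
case: q pq qS => [|a q] /=; first by rewrite st_free.
move=> /andP[sa pq] qS.
have aS : a \in S by apply: qS; rewrite mem_head.
have [walk_s _] := walk q (fun z zp => qS z (mem_behead (s := a :: q) zp)).
exact: walk_s pq.
Qed.

Variables (matched_s : forall a b c, e s a -> e a b -> e a c -> e b t -> e c t -> b = c).
Variables (matched_t : forall a b c, e a t -> e b a -> e c a -> e s b -> e s c -> b = c).

(** Edges between the two borders, in either orientation; excluding forks makes them a matching. *)
Definition match_edge (x y : T) : bool :=
  e x y && (e s x && e y t || e x t && e s y).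

Lemma match_edge_sym : symmetric match_edge.
Proof.
by move=> x y; rewrite /match_edge e_sym orbC [e x t && _]andbC [e s x && _]andbC.
Qed.

Lemma match_edge_fun x y z : match_edge x y -> match_edge x z -> y = z.
Proof.
move=> /andP[xy /orP[/andP[sx yt]|/andP[xt sy]]].
  move=> /andP[xz /orP[/andP[_ zt]|/andP[xt _]]]; first exact: (@matched_s x).
  by case: (disjoint_borders sx xt).
move=> /andP[xz /orP[/andP[sx _]|/andP[_ sz]]].
  by case: (disjoint_borders sx xt).
by apply: (@matched_t x) => //; rewrite e_sym.
Qed.

Lemma match_edge_irr : irreflexive match_edge.
Proof. by move=> x; rewrite /match_edge e_irr. Qed.

Lemma match_edgeP a c : e s a -> e c t -> e a c -> match_edge a c.
Proof. by move=> sa ct ac; rewrite /match_edge ac sa ct. Qed.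

Lemma match_edge_v y : match_edge v y = false.
Proof. by rewrite /match_edge sv vt /= andbF. Qed.

Lemma matching_cut_wins :
  (forall a c, e s a -> e c t -> e a v -> e v c -> e a c) ->
  ~ short_wins e s t true.
Proof.
move=> short_cut.
apply: (pairing_cut_wins match_edge_sym match_edge_fun match_edge_irr).
move=> S SN /(connects_cross SN)[a [c [aS cS sa ct ac]]].
exists a, c; split=> //; apply: match_edgeP => //.
by case: ac => [//|[_ av vc]]; apply: short_cut.
Qed.

(** As [k] and [v] lie on no matching edge, adding the pair {k, v} keeps a matching, and it covers
    the triples whose ends are not adjacent. *)
Lemma matching_with_v_cut_wins k : k != v -> (forall y, ~~ match_edge k y) ->
  (forall a c, e s a -> e c t -> e a v -> e v c -> [|| e a c, a == k | c == k]) ->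
  ~ short_wins e s t true.
Proof.
move=> kv unmatched cover.
pose r x y := [|| match_edge x y, (x == k) && (y == v) | (x == v) && (y == k)].
have rk y : r k y -> y = v.
  by rewrite /r (negbTE (unmatched y)) (negbTE kv) eqxx orbF => /eqP.
have rv y : r v y -> y = k.
  by rewrite /r match_edge_v eqxx [v == k]eq_sym (negbTE kv) => /eqP.
have rm x y : x != k -> x != v -> r x y -> match_edge x y.
  by rewrite /r => /negbTE-> /negbTE->; rewrite !orbF.
apply: (@pairing_cut_wins _ s t e r).
- move=> x y; rewrite /r match_edge_sym; congr orb.
  by rewrite orbC; congr orb; apply: andbC.
- move=> x y z; have [->|xk] := eqVneq x k; first by move=> /rk-> /rk->.
  have [->|xv] := eqVneq x v; first by move=> /rv-> /rv->.
  by move=> /(rm _ _ xk xv) xy /(rm _ _ xk xv); apply: match_edge_fun.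
- move=> x; rewrite /r match_edge_irr /=; apply/negbTE.
  by have [->|] := eqVneq x k; rewrite ?(negbTE kv) ?andbF.
move=> S SN /(connects_cross SN)[a [c [aS cS sa ct]]].
have [ac _|nac] := boolP (e a c).
  by exists a, c; rewrite /r match_edgeP.
case=> [//|[vS av vc]].
have := cover a c sa ct av vc; rewrite (negbTE nac) /= => /orP[] /eqP kE.
  by exists a, v; split=> //; rewrite /r kE !eqxx orbT.
by exists v, c; split=> //; rewrite /r kE !eqxx !orbT.
Qed.

End Cut.

(** * The weight bound for at most one centre vertex *)

Lemma weight_bound : minimal_weak_link e s t -> #|centre e s t| <= 1 ->
  weight s t <= 3 + #|centre e s t|.*2.
Proof.
move=> emin centre_le1.
have [v [sv vt centre_v]] : exists v, [/\ e s v = false, e v t = false &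
    {subset centre e s t <= [set v]}].
  case: (set_0Vmem (centre e s t)) => [c0|[v vC]].
    (* With an empty centre [s] serves as a dummy [v], being adjacent to neither terminal. *)
    by exists s; split=> [|//|x]; rewrite ?e_irr // c0 in_set0.
  exists v; move: (vC); rewrite !inE negb_or [e t v]e_sym.
  move=> /andP[/andP[/negbTE-> /negbTE->] _]; split=> // x xC; rewrite inE.
  by move/card_le1_eqP: centre_le1 => /(_ x v xC vC)->.
apply: contraT; rewrite -ltnNge => large.
have no3 : ~ weight s t <= #|centre e s t| + 3 by lia.
have no4 : ~ (0 < #|centre e s t| /\ weight s t <= #|centre e s t| + 4) by lia.
have matched_s a b c : e s a -> e a b -> e a c -> e b t -> e c t -> b = c.
  move=> sa ab ac bt ct; apply/eqP/contraT => bc.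
  by case: no3; apply: fork_s_weight ab ac bt ct bc.
have matched_t a b c : e a t -> e b a -> e c a -> e s b -> e s c -> b = c.
  move=> at_ ba ca sb sc; apply/eqP/contraT => bc.
  by case: no3; apply: fork_t_weight ba ca sb sc bc.
case: (emin) => [[win _] _]; exfalso; move: win.
have matching := matching_cut_wins vt centre_v matched_s matched_t.
have with_v := matching_with_v_cut_wins sv vt centre_v matched_s matched_t.
(* A triple a v c with ac an edge is met by the matching, so only the gaps ask *)
(* for the extra pair; as no first-mover win occurs, one end of a gap is       *)
(* unmatched and lies in all gaps.                                             *)
pose gap a c := [&& e s a, e c t, e a v, e v c & ~~ e a c].
case: (pickP (fun ac => gap ac.1 ac.2)) => [[a c]|none]; last first.
  apply: matching => a c sa ct av vc; have := none (a, c).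
  by rewrite /gap /= sa ct av vc => /negbT; rewrite negbK.
rewrite /gap /= => /and5P[sa ct av vc nac].
have av_neq : a != v by apply: e_neq.
have cv_neq : c != v by rewrite eq_sym; apply: e_neq.
have unmatched_s x : e s x -> (forall b, e x b -> e b t -> False) ->
    forall y, ~~ match_edge x y.
  move=> sx none y; apply/negP => /andP[xy /orP[/andP[_ yt]|/andP[xt _]]].
    exact: none xy yt.
  exact: disjoint_borders sx xt.
have unmatched_t x : e x t -> (forall b, e b x -> e s b -> False) ->
    forall y, ~~ match_edge x y.
  move=> xt none y; apply/negP => /andP[xy /orP[/andP[sx _]|/andP[_ sy]]].
    exact: disjoint_borders sx xt.
  by apply: none sy; rewrite e_sym.
have both b a' : e a b -> e b t -> e a' c -> e s a' -> False.
  move=> ab bt a'c sa'; case: no4.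
  apply: (matched_both_weight emin sv vt sa ab bt av vc ct a'c sa').
    by apply: contraNneq nac => <-.
  by apply: contraNneq nac => <-.
(* If [v] has a second neighbour in the border of [s], excluding the square makes [c] its only one
   in the border of [t], so every gap ends at [c]. Otherwise every gap starts at [a], and the
   argument is mirrored. *)
case: (pickP (fun a' => [&& e s a', e a' v & a' != a])) => [a2 /and3P[sa2 a2v a2a]|only_a].
  have only_c x : e v x -> e x t -> x = c.
    move=> vx xt; apply/eqP/contraT => xc; case: no4.
    exact: (square_weight emin sv vt sa2 sa xt ct a2v av vx vc a2a xc).
  case: (pickP (fun b => e b c && e s b)) => [b /andP[bc sb]|free_c]; last first.
    apply: (with_v c) => // [|x y sx yt xv vy]; last by rewrite (only_c y) ?eqxx ?orbT.
    by apply: unmatched_t => // b bc sb; have := free_c b; rewrite bc sb.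
  (* As [c] is matched to [b], [a] is unmatched. A gap from another [x] would give the configuration
     of [matched_t_weight]. *)
  apply: (with_v a) => // [|x y sx yt xv vy].
    by apply: unmatched_s => // b' ab' b't; apply: both bc sb; eassumption.
  rewrite (only_c y) //; have [->|xa] := eqVneq x a; first by rewrite orbT.
  have [->|xb] := eqVneq x b; first by rewrite bc.
  case: no4; apply: (matched_t_weight emin sv vt ct bc sb vc av xv sa sx) => //.
    by rewrite eq_sym.
  by apply: contraNneq nac => ->.
have {}only_a x : e s x -> e x v -> x = a.
  by move=> sx xv; apply/eqP/contraT => xa; have := only_a x; rewrite sx xv xa.
case: (pickP (fun b => e a b && e b t)) => [b /andP[ab bt]|free_a]; last first.
  apply: (with_v a) => // [|x y sx yt xv vy]; last by rewrite (only_a x) ?eqxx ?orbT.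
  by apply: unmatched_s => // b ab bt; have := free_a b; rewrite ab bt.
apply: (with_v c) => // [|x y sx yt xv vy].
  by apply: unmatched_t => // b' b'c sb'; apply: both ab bt b'c sb'.
rewrite (only_a x) //; have [->|yc] := eqVneq y c; first by rewrite !orbT.
have [->|yb] := eqVneq y b; first by rewrite ab.
case: no4; apply: (matched_s_weight emin sv vt sa ab bt av vc vy ct yt) => //.
  by rewrite eq_sym.
by apply: contraNneq nac => ->.
Qed.

Lemma degree_sum_centre :
  degree e s + degree e t + #|centre e s t| = weight s t.
Proof.
have borders_NT : nbhd e s :|: nbhd e t \subset NT.
  apply/subsetP => x; rewrite in_setU [x \in nbhd e s]in_set [x \in nbhd e t]in_set => /orP[sx|tx].
    exact: border_s_NT.
  by apply: border_t_NT; rewrite e_sym.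
rewrite /weight -(cardsID (nbhd e s :|: nbhd e t) NT) (setIidPr borders_NT).
congr (_ + _); rewrite -cardsUI.
suff -> : nbhd e s :&: nbhd e t = set0 by rewrite cards0 addn0.
apply/setP => x; rewrite !inE; apply/negbTE/negP => /andP[sx tx].
by apply: (disjoint_borders sx); rewrite e_sym.
Qed.

End Borders.

(** * Terminals at distance at most two, and the conclusion *)

(** The empty route would win without any move, making the link strong. *)
Lemma terminals_nonadjacent (T : finType) (e : rel T) (s t : T) :
  s != t -> weak_link e s t -> e s t = false.
Proof.
move=> st [_ not_strong]; apply: contra_notF not_strong => est.
apply: (@routes_short_wins _ _ _ _ _ 0 [:: [::]]).
  by rewrite /= /route /= est inE !andbT.
by move=> y; rewrite /= /covers.
Qed.

(** Claiming [x] wins at once, so by minimality all edges lie within {s, x, t}. *)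
Lemma common_neighbour (T : finType) (e : rel T) (s t x : T) :
  symmetric e -> irreflexive e -> s != t -> minimal_weak_link e s t ->
  e s x -> e x t ->
  degree e s + degree e t <= 2 /\ weight s t <= #|centre e s t| + 1.
Proof.
move=> e_sym e_irr st emin sx xt.
have st_free := terminals_nonadjacent st emin.1.
have rF : all (route s t e) [:: [:: x]].
  rewrite /route /= sx xt !inE negb_or st !andbT /=.
  have -> : s != x by apply: contraTneq sx => <-; rewrite e_irr.
  by apply: contraTneq xt => ->; rewrite e_irr.
have xN : x \in nonterminals s t by apply: border_s_NT.
have att : attack (covers [:: [:: x]]) 1 set0 (nonterminals s t).
  by apply: (attack_finish _ xN); rewrite /covers /= !inE eqxx.
split; last first.
  apply: (@weight_le_centre _ _ _ e 1 [:: [:: x]] [:: x]) => //.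
  by move=> y /= ->.
have deg1 z : z \in [:: s; t] -> degree e z <= 1.
  move=> zst; rewrite -(cards1 x); apply/subset_leq_card/subsetP => y; rewrite !inE => zy.
  have := minimal_support emin rF att (etrans (e_sym y z) zy).
  move: zst zy; rewrite !inE.
  case/orP=> /eqP-> zy; case/or3P=> // /eqP yE; move: zy; rewrite yE ?e_irr //.
    by rewrite st_free.
  by rewrite e_sym st_free.
by apply: (leq_add (deg1 s _) (deg1 t _)); rewrite !inE eqxx ?orbT.
Qed.

Theorem theorem1 (T : finType) (e : rel T) (s t : T)
    (e_sym : symmetric e) (e_irr : irreflexive e) (s_neq_t : s != t)
    (min_weak : minimal_weak_link e s t) :
  [/\ 3 < weight s t -> 1 <= #|centre e s t|,
      5 < weight s t -> 2 <= #|centre e s t| &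
      weight s t <= 7 ->
        ((degree e s + degree e t)%:R <= (weight s t + 3)%:R / 2%:R :> rat)%R].
Proof.
have ratE d w : d.*2 <= w + 3 -> (d%:R <= (w + 3)%:R / 2%:R :> rat)%R.
  move=> dw; rewrite Num.Theory.ler_pdivlMr ?Num.Theory.ltr0n //.
  by rewrite -GRing.natrM Num.Theory.ler_nat muln2.
have st_free := terminals_nonadjacent s_neq_t min_weak.1.
case: (pickP (fun x => e s x && e x t)) => [x /andP[sx xt]|disj].
  have [deg2 wp] := common_neighbour e_sym e_irr s_neq_t min_weak sx xt.
  have w_gt0 : 0 < weight s t.
    by apply/card_gt0P; exists x; apply: (border_s_NT e_irr st_free sx).
  by split=> [w3|w5|_]; last apply: ratE; lia.
have disjoint_borders x : e s x -> e x t -> False.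
  by move=> sx xt; have := disj x; rewrite sx xt.
have sum := degree_sum_centre e_sym e_irr st_free disjoint_borders.
have bound := weight_bound e_sym e_irr s_neq_t st_free disjoint_borders min_weak.
(* This disjunction and d_s + d_t + p = w are all that the three claims need; the rest is linear
   arithmetic. *)
have {bound} : 1 < #|centre e s t| \/ weight s t <= 3 + #|centre e s t|.*2.
  by case: (leqP #|centre e s t| 1) => [/bound|]; [right|left].
move: sum ratE; move: (weight s t) #|centre e s t| (degree e s) (degree e t).
by move=> w p ds dt sum ratE bound; split=> [?|?|?]; last apply: ratE; lia.
Qed.
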